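(* Let $(R, \mathfrak{m})$ be a commutative noetherian local ring with maximal ideal $\mathfrak{m}$. Let $\mathcal{S}_{f.g.}$ be the class of all finitely generated $R$-modules, let $\mathcal{M}_{f.s.}$ be the class of all $R$-modules with finite support, and let $(\mathcal{S}_{f.g.}, \mathcal{M}_{f.s.})$ be the class of all $R$-modules $X$ for which there exist $S \in \mathcal{S}_{f.g.}$, $M \in \mathcal{M}_{f.s.}$ and a short exact sequence of $R$-modules $0 \to S \to X \to M \to 0$. Then the following assertions hold. (1) If $R$ has infinitely many prime ideals, then $(\mathcal{S}_{f.g.}, \mathcal{M}_{f.s.})$ is not closed under injective hulls. (2) If $R$ is a $2$-dimensional local domain, then $(\mathcal{S}_{f.g.}, \mathcal{M}_{f.s.})$ is a Melkersson subcategory. In particular, if $R$ is a $2$-dimensional local domain with infinitely many prime ideals, then $(\mathcal{S}_{f.g.}, \mathcal{M}_{f.s.})$ is a Melkersson subcategory which is not closed under injective hulls.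
   Context: All rings are commutative noetherian and all modules are unitary and not necessarily finitely generated unless said so. Dimension means Krull dimension. All classes (full subcategories) of modules are assumed closed under isomorphism. An $R$-module $M$ has finite support if $\mathrm{Supp}(M)=\{\mathfrak{p}\in\mathrm{Spec}(R) \mid M_{\mathfrak{p}}\neq 0\}$ is a finite set. A class of $R$-modules is closed under injective hulls if for every $M$ in the class the injective hull $E_R(M)$ is also in the class. A class $\mathcal{S}$ of $R$-modules is a Serre subcategory of the category $R\text{-}\mathrm{Mod}$ of all $R$-modules if it is closed under submodules, quotients and extensions. For an ideal $I$ of $R$ and an $R$-module $M$, put $\Gamma_I(M)=\{x\in M \mid I^n x=0 \text{ for some } n\geq 1\}$ and $(0:_M I)=\{x\in M\mid Ix=0\}$. A Serre subcategory $\mathcal{S}$ of $R\text{-}\mathrm{Mod}$ satisfies the condition $C_I$ if: for every $R$-module $M$, if $M=\Gamma_I(M)$ and $(0:_M I)$ is in $\mathcal{S}$, then $M$ is in $\mathcal{S}$. A Melkersson subcategory is a Serre subcategory of $R\text{-}\mathrm{Mod}$ that satisfies the condition $C_I$ for all ideals $I$ of $R$. *)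

(* Defs.v *)
From HB Require Import structures.
From mathcomp Require Import all_boot all_order all_algebra.
From mathcomp Require Import mathcomp_extra boolp classical_sets functions.
From mathcomp Require Import cardinality.

Set Implicit Arguments.
Unset Strict Implicit.
Unset Printing Implicit Defensive.

Import GRing.Theory.
Local Open Scope classical_set_scope.
Local Open Scope ring_scope.

Section Submodules.
Variables (R : comNzRingType) (M : lmodType R).

Definition submodule (N : set M) : Prop := GRing.submod_closed [in N].

Definition generated_by (n : nat) (e : 'I_n -> M) : set M :=
  [set \sum_(i < n) c i *: e i | c in [set: 'I_n -> R]].

Definition finitely_generated : Prop :=
  exists (n : nat) (e : 'I_n -> M), generated_by e = setT.

End Submodules.

Section Ideals.
Variable R : comNzRingType.

(* Ideals are not required to be proper, unlike those of ring_quotient. *)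
Definition ideal (I : set R) : Prop := submodule (I : set R^o).

Definition noetherian : Prop :=
  forall I : set R, ideal I ->
    exists (n : nat) (e : 'I_n -> R^o), generated_by e = I.

Definition prime_ideal (p : set R) : Prop :=
  [/\ ideal p, ~ p 1 & forall a b, p (a * b) -> p a \/ p b].

Definition maximal_ideal (m : set R) : Prop :=
  [/\ ideal m, ~ m 1 &
      forall J, ideal J -> m `<=` J -> ~ J 1 -> J = m].

Definition local_with_maximal_ideal (m : set R) : Prop :=
  maximal_ideal m /\ forall m', maximal_ideal m' -> m' = m.

Definition Spec : set (set R) := [set p | prime_ideal p].

Definition prime_chain (n : nat) (p : nat -> set R) : Prop :=
  (forall i, (i <= n)%N -> prime_ideal (p i)) /\
  (forall i, (i < n)%N -> p i `<` p i.+1).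

Definition has_krull_dim (d : nat) : Prop :=
  (exists p, prime_chain d p) /\
  (forall n p, prime_chain n p -> (n <= d)%N).

Definition ideal_mul (I J : set R) : set R :=
  [set x | exists (n : nat) (a b : 'I_n -> R),
     [/\ forall i, I (a i), forall i, J (b i) & x = \sum_(i < n) a i * b i]].

Definition ideal_pow (I : set R) (n : nat) : set R :=
  iter n (ideal_mul I) setT.

End Ideals.

Arguments Spec R : clear implicits.

Section Support.
Variables (R : comNzRingType) (M : lmodType R).

(* The fraction x / s of M_p, as the set of all pairs (y, t) with t outside p
   that are equivalent to (x, s). *)
Definition fraction (p : set R) (x : M) (s : R) : set (M * R) :=
  [set yt | ~ p yt.2 /\
            exists2 u, ~ p u & u *: (yt.2 *: x - s *: yt.1) = 0].

(* The underlying set of M_p. *)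
Definition localization (p : set R) : set (set (M * R)) :=
  [set z | exists x s, ~ p s /\ z = fraction p x s].

Definition Supp : set (set R) :=
  [set p | prime_ideal p /\ localization p <> [set fraction p 0 1]].

Definition finite_support : Prop := finite_set Supp.

End Support.

Arguments Supp {R} M.

Section Torsion.
Variables (R : comNzRingType) (I : set R) (M : lmodType R).

Definition Gamma : set M :=
  [set x | exists2 n, (1 <= n)%N & forall a, ideal_pow I n a -> a *: x = 0].

Definition annihilated : {pred M} :=
  [pred x | `[< forall a, I a -> a *: x = 0 >]].

Fact annihilated_submod_closed : GRing.submod_closed annihilated.
Proof.
split; first by apply/asboolP => a _; rewrite scaler0.
move=> b x y /asboolP hx /asboolP hy; apply/asboolP => a Ia.
by rewrite scalerDr scalerA mulrC -scalerA hx // hy // scaler0 addr0.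
Qed.

HB.instance Definition _ :=
  GRing.isSubmodClosed.Build R M annihilated annihilated_submod_closed.

(* (0 :_M I) as an R-module. *)
Record annihilated_mod : Type := AnnihilatedMod {
  annihilated_val :> M;
  _ : annihilated_val \in annihilated }.

HB.instance Definition _ := [isSub for annihilated_val].
HB.instance Definition _ := [Choice of annihilated_mod by <:].
HB.instance Definition _ :=
  [SubChoice_isSubLmodule of annihilated_mod by <:].

End Torsion.

Arguments Gamma {R} I M.
Arguments annihilated_mod {R} I M.

Section Classes.
Variable R : comNzRingType.

Definition module_class : Type := lmodType R -> Prop.

Definition surjective (M N : lmodType R) (g : M -> N) : Prop :=
  forall y, exists x, g x = y.

Definition short_exact (L M N : lmodType R)
    (f : {linear L -> M}) (g : {linear M -> N}) : Prop :=
  [/\ injective f, range f = [set x | g x = 0] & surjective g].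

Definition extension_class (C D : module_class) : module_class :=
  fun X => exists (S M : lmodType R)
      (f : {linear S -> X}) (g : {linear X -> M}),
    [/\ C S, D M & short_exact f g].

Definition closed_under_submodules (C : module_class) : Prop :=
  forall (N M : lmodType R) (f : {linear N -> M}),
    injective f -> C M -> C N.

Definition closed_under_quotients (C : module_class) : Prop :=
  forall (M N : lmodType R) (g : {linear M -> N}),
    surjective g -> C M -> C N.

Definition closed_under_extensions (C : module_class) : Prop :=
  forall (L M N : lmodType R) (f : {linear L -> M}) (g : {linear M -> N}),
    short_exact f g -> C L -> C N -> C M.

Definition serre_subcategory (C : module_class) : Prop :=
  [/\ closed_under_submodules C, closed_under_quotients C &
      closed_under_extensions C].

Definition condition_C (I : set R) (C : module_class) : Prop :=
  forall M : lmodType R,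
    Gamma I M = setT -> C (annihilated_mod I M) -> C M.

Definition melkersson_subcategory (C : module_class) : Prop :=
  serre_subcategory C /\ forall I : set R, ideal I -> condition_C I C.

Definition injective_module (E : lmodType R) : Prop :=
  forall (A B : lmodType R) (f : {linear A -> B}) (h : {linear A -> E}),
    injective f -> exists h' : {linear B -> E}, forall x, h' (f x) = h x.

Definition essential (M E : lmodType R) (i : {linear M -> E}) : Prop :=
  forall N : set E, submodule N -> N `&` range i = [set 0] -> N = [set 0].

Definition injective_hull (M E : lmodType R) (i : {linear M -> E}) : Prop :=
  [/\ injective i, essential i & injective_module E].

Definition closed_under_injective_hulls (C : module_class) : Prop :=
  forall (M E : lmodType R) (i : {linear M -> E}),
    injective_hull i -> C M -> C E.

Definition fg_modules : module_class := fun M => finitely_generated M.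

Definition fs_modules : module_class := fun M => finite_support M.

End Classes.

(* Main.v *)
Require Import Defs.
From HB Require Import structures.
From mathcomp Require Import all_boot all_order all_algebra.
From mathcomp Require Import mathcomp_extra boolp classical_sets functions.
From mathcomp Require Import cardinality.

(** Call a module X good if it has a finitely generated submodule N such that
    X/N has finite support; [fg_fs_classP] identifies the good modules with the
    class (S_fg, M_fs), so that the whole argument can be carried out with
    submodules of a fixed module and with the set [quotient_support N] of the
    primes p such that some x in X has no multiple u x in N with u outside p.

    Good modules form a Serre subcategory over any noetherian ring
    ([fg_fs_serre]): restrict N to a submodule, push it forward to a quotient,
    and for an extension add to the submodule of the kernel a finitely
    generated lift of the submodule of the quotient.

    For the conditions C_I in a 2-dimensional local domain, the case I = 0 is
    trivial since (0 :_M 0) = M. If I is nonzero, then the primes containing I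
    are finite in number: a noetherian ring has finitely many primes minimal
    over I ([finitely_many_primes_over]), and a prime over I that is neither
    one of these nor m would be the third term of a chain 0 < p < q < m. An
    I-torsion module is supported on these primes ([Supp_Gamma]), so it is good
    because it has finite support.

    Now let R have infinitely many primes. As every prime contains one of the
    finitely many minimal primes, some prime p lies in infinitely many primes.
    Let E be an injective hull of R/p; while R/p is finitely generated, E is
    not good. Indeed, let S be a finitely generated submodule of E and q a
    prime strictly containing p, and pick r in q outside p. The submodule
    P of the elements of E killed by p satisfies P = r P, because E is
    injective ([injective_divide]). If q were not in the support of E/S, then
    P would agree locally at q with the finitely generated module
    P `&` S, which would vanish locally at q by Nakayama's lemma
    ([nakayama_prime]); but P contains R/p, which does not vanish at q. So the
    support of E/S contains all primes strictly above p
    ([quotient_support_injective]).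

    The existence of an injective hull of R/p has to be proved as well. The
    group Q/Z is divisible, so by Baer's criterion over the integers any power
    of it is an injective Z-module, and then the additive maps from R to such
    a power form an injective R-module, in which enough characters of R/p
    yield an element with annihilator p ([exists_injective_annihilator]). A
    maximal essential extension of a submodule inside an injective module is a
    direct summand, hence injective ([exists_injective_hull]). *)

Set Implicit Arguments.
Unset Strict Implicit.
Unset Printing Implicit Defensive.

Import Order.TTheory GRing.Theory Num.Theory.
Local Open Scope quotient_scope.
Local Open Scope classical_set_scope.
Local Open Scope ring_scope.

(** * Submodules, and submodules and quotients as modules *)

Section SubmoduleTheory.
Variables (R : comNzRingType) (M : lmodType R).
Implicit Types N : set M.

(** Membership in the set N is propositional here, whereas [submodule] speaks of
    the boolean predicate [in N]. *)
Lemma submoduleP N :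
  submodule N <-> N 0 /\ forall a x y, N x -> N y -> N (a *: x + y).
Proof.
split=> [[N0 NL]|[N0 NL]].
  split; first by move: N0; rewrite inE.
  by move=> a x y Nx Ny; have := NL a x y; rewrite !inE; apply.
by split; [rewrite inE|move=> a x y; rewrite !inE; exact: NL].
Qed.

Lemma submodule0 N : submodule N -> N 0.
Proof. by move/submoduleP => []. Qed.

Lemma submoduleZ N a x : submodule N -> N x -> N (a *: x).
Proof.
by move/submoduleP => [N0 NL] Nx; rewrite -[_ *: _]addr0; apply: NL.
Qed.

Lemma submoduleD N x y : submodule N -> N x -> N y -> N (x + y).
Proof. by move/submoduleP => [N0 NL] Nx Ny; rewrite -[x]scale1r; apply: NL. Qed.

Lemma submoduleN N x : submodule N -> N x -> N (- x).
Proof. by move=> hN Nx; rewrite -scaleN1r; apply: submoduleZ. Qed.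

Lemma submoduleB N x y : submodule N -> N x -> N y -> N (x - y).
Proof. by move=> hN Nx Ny; apply: submoduleD => //; apply: submoduleN. Qed.

Lemma submodule_sum N n (F : 'I_n -> M) :
  submodule N -> (forall i, N (F i)) -> N (\sum_(i < n) F i).
Proof.
move=> hN hF; elim/big_rec: _ => [|i x _ Nx]; first exact: submodule0.
exact: submoduleD.
Qed.

Lemma submoduleT : submodule [set: M].
Proof. exact/submoduleP. Qed.

Lemma submodule_set0 : submodule [set 0 : M].
Proof.
by apply/submoduleP; split=> // a x y /= -> ->; rewrite scaler0 addr0.
Qed.

Lemma submoduleI N1 N2 : submodule N1 -> submodule N2 -> submodule (N1 `&` N2).
Proof.
move=> /submoduleP[A1 A2] /submoduleP[B1 B2]; apply/submoduleP; split=> //.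
by move=> a x y [? ?] [? ?]; split; [apply: A2|apply: B2].
Qed.

Definition submodule_add N1 N2 : set M :=
  [set z | exists x y, [/\ N1 x, N2 y & z = x + y]].

Lemma submodule_addP N1 N2 :
  submodule N1 -> submodule N2 -> submodule (submodule_add N1 N2).
Proof.
move=> h1 h2; apply/submoduleP; split.
  by exists 0, 0; rewrite addr0; split=> //; apply: submodule0.
move=> a _ _ [x [y [Nx Ny ->]]] [x' [y' [Nx' Ny' ->]]].
exists (a *: x + x'), (a *: y + y'); rewrite scalerDr addrACA.
by split=> //; apply: submoduleD => //; apply: submoduleZ.
Qed.

Lemma sub_submodule_addl N1 N2 : submodule N2 -> N1 `<=` submodule_add N1 N2.
Proof. by move=> h x Nx; exists x, 0; rewrite addr0; split=> //; apply: submodule0. Qed.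

Lemma sub_submodule_addr N1 N2 : submodule N1 -> N2 `<=` submodule_add N1 N2.
Proof. by move=> h x Nx; exists 0, x; rewrite add0r; split=> //; apply: submodule0. Qed.

Definition cyclic_submodule (x : M) : set M := [set a *: x | a in [set: R]].

Lemma cyclic_submoduleP x : submodule (cyclic_submodule x).
Proof.
apply/submoduleP; split; first by exists 0 => //; rewrite scale0r.
move=> a _ _ [b _ <-] [c _ <-]; exists (a * b + c) => //.
by rewrite scalerDl scalerA.
Qed.

Lemma mem_cyclic_submodule x : cyclic_submodule x x.
Proof. by exists 1 => //; rewrite scale1r. Qed.

End SubmoduleTheory.

Section ImagePreimage.
Variables (R : comNzRingType) (M N : lmodType R) (f : {linear M -> N}).

Lemma submodule_image (A : set M) : submodule A -> submodule (f @` A).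
Proof.
move=> hA; apply/submoduleP; split; first by exists 0; [exact: submodule0|exact: linear0].
move=> a _ _ [x Ax <-] [y Ay <-]; exists (a *: x + y); last by rewrite linearP.
by apply: submoduleD => //; apply: submoduleZ.
Qed.

Lemma submodule_preimage (A : set N) : submodule A -> submodule (f @^-1` A).
Proof.
move=> hA; apply/submoduleP; rewrite /preimage /= linear0.
split=> [|a x y Ax Ay]; first exact: submodule0.
by rewrite /= linearP; apply: submoduleD => //; apply: submoduleZ.
Qed.

End ImagePreimage.

Section SubQuotient.
Variables (R : comNzRingType) (M : lmodType R) (N : set M) (hN : submodule N).

(** The proof that N is a submodule is an argument, so that the closure
    properties can be found by unification from the predicate alone. *)
Definition submod_pred of submodule N : {pred M} := [in N].

Fact submod_pred_closed : GRing.submod_closed (submod_pred hN).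
Proof. exact: hN. Qed.

HB.instance Definition _ :=
  GRing.isSubmodClosed.Build R M (submod_pred hN) submod_pred_closed.

Record submod : Type := Submod { submod_val :> M; _ : submod_val \in submod_pred hN }.

HB.instance Definition _ := [isSub for submod_val].
HB.instance Definition _ := [Choice of submod by <:].
HB.instance Definition _ := [SubChoice_isSubLmodule of submod by <:].

Definition submod_incl (x : submod) : M := val x.

Lemma submod_incl_linear : linear submod_incl.
Proof. by move=> a x y. Qed.

HB.instance Definition _ :=
  GRing.isLinear.Build R submod M *:%R submod_incl submod_incl_linear.

Lemma submod_incl_inj : injective submod_incl.
Proof. exact: val_inj. Qed.

Lemma submod_inclP (x : submod) : N (submod_incl x).
Proof. by case: x => x hx; apply: set_mem hx. Qed.

Lemma submod_incl_surj x : N x -> exists y : submod, submod_incl y = x.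
Proof. by move=> Nx; exists (Submod (mem_set Nx : x \in submod_pred hN)). Qed.

Lemma range_submod_incl : range submod_incl = N.
Proof.
apply/seteqP; split=> [_ [x _ <-]|x /submod_incl_surj[y <-]]; last by exists y.
exact: submod_inclP.
Qed.

Definition quotmod : Type := Quotient.quot (submod_pred hN).
HB.instance Definition _ := GRing.Zmodule.on quotmod.

Definition quotmod_pi (x : M) : quotmod := \pi_(Quotient.quot (submod_pred hN)) x.

Lemma quotmod_pi_eq x y : quotmod_pi x = quotmod_pi y <-> N (x - y).
Proof.
split=> [/eqP|Nxy]; first by rewrite -Quotient.idealrBE inE.
by apply/eqP; rewrite -Quotient.idealrBE inE.
Qed.

Lemma quotmod_pi_surj y : exists x, quotmod_pi x = y.
Proof. by exists (repr y); rewrite /quotmod_pi reprK. Qed.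

Definition quotmod_scale (a : R) (y : quotmod) : quotmod := quotmod_pi (a *: repr y).

Lemma quotmod_scale_pi a x : quotmod_scale a (quotmod_pi x) = quotmod_pi (a *: x).
Proof.
apply/quotmod_pi_eq; rewrite -scalerBr; apply: submoduleZ => //.
by apply/quotmod_pi_eq; rewrite /quotmod_pi reprK.
Qed.

Lemma quotmod_piD x y : quotmod_pi (x + y) = quotmod_pi x + quotmod_pi y.
Proof. by rewrite /quotmod_pi raddfD. Qed.

Fact quotmod_scaleA a b v :
  quotmod_scale a (quotmod_scale b v) = quotmod_scale (a * b) v.
Proof. by have [x <-] := quotmod_pi_surj v; rewrite !quotmod_scale_pi scalerA. Qed.
Fact quotmod_scale1 : left_id 1 quotmod_scale.
Proof. by move=> v; have [x <-] := quotmod_pi_surj v; rewrite !quotmod_scale_pi scale1r. Qed.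
Fact quotmod_scaleDr : right_distributive quotmod_scale +%R.
Proof.
move=> a u v; have [x <-] := quotmod_pi_surj u; have [y <-] := quotmod_pi_surj v.
by rewrite -quotmod_piD !quotmod_scale_pi scalerDr quotmod_piD.
Qed.
Fact quotmod_scaleDl v : {morph quotmod_scale^~ v : a b / a + b}.
Proof.
move=> a b; have [x <-] := quotmod_pi_surj v.
by rewrite !quotmod_scale_pi scalerDl quotmod_piD.
Qed.

HB.instance Definition _ := GRing.Zmodule_isLmodule.Build R quotmod
  quotmod_scaleA quotmod_scale1 quotmod_scaleDr quotmod_scaleDl.

Lemma quotmod_pi_linear : linear quotmod_pi.
Proof. by move=> a x y; rewrite quotmod_piD -quotmod_scale_pi. Qed.

HB.instance Definition _ :=
  GRing.isLinear.Build R M quotmod *:%R quotmod_pi quotmod_pi_linear.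

Lemma quotmod_pi0 x : quotmod_pi x = 0 <-> N x.
Proof. by rewrite -(linear0 quotmod_pi) quotmod_pi_eq subr0. Qed.

Lemma short_exact_quotmod : short_exact submod_incl quotmod_pi.
Proof.
split; [exact: submod_incl_inj| |exact: quotmod_pi_surj].
by rewrite range_submod_incl; apply/seteqP; split=> x /= /quotmod_pi0.
Qed.

End SubQuotient.

(** * Finite generation and prime ideals over a noetherian ring *)

Section ZornChains.
Variable T : Type.

(** Only nonempty chains have to be bounded, because the chains of sets containing
    [A0] start at [A0]; this is what makes the lemma applicable to families of
    submodules, which do not contain the empty set. *)
Lemma Zorn_above (P : set (set T)) (A0 : set T) :
    P A0 ->
    (forall F : set (set T), F !=set0 -> F `<=` P -> total_on F subset ->
       P (\bigcup_(X in F) X)) ->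
  exists A, [/\ P A, A0 `<=` A & forall B, A `<=` B -> P B -> B = A].
Proof.
move=> PA0 Pchain.
have [F FP totF|A [PA maxA]] := @Zorn_bigcup T [set B | P (A0 `|` B)].
  have [->|/set0P[X0 FX0]] := eqVneq F set0.
    by rewrite /= bigcup_set0 setU0.
  have -> : [set B | P (A0 `|` B)] (\bigcup_(X in F) X) =
            P (\bigcup_(Y in [set A0 `|` X | X in F]) Y).
    rewrite /=; congr P; apply/seteqP; split=> x.
      case=> [A0x|[X FX Xx]]; first by exists (A0 `|` X0); [exists X0|left].
      by exists (A0 `|` X); [exists X|right].
    by case=> _ [X FX <-] [A0x|Xx]; [left|right; exists X].
  apply: Pchain; first by exists (A0 `|` X0), X0.
    by move=> _ [X FX <-]; apply: FP.
  move=> _ _ [X FX <-] [Y FY <-].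
  by have [XY|YX] := totF X Y FX FY; [left|right]; apply: setUS.
exists (A0 `|` A); split=> // B AB PB; apply/seteqP; split=> //.
have AsubB : A `<=` B by move=> x Ax; apply: AB; right.
have [BA|nBA] := pselect (B `<=` A); first by move=> x /BA Ax; right.
case: (maxA B); first by split.
rewrite /= (_ : A0 `|` B = B) //; apply/seteqP; split=> [x [A0x|//]|x]; last by right.
by apply: AB; left.
Qed.

(** Finitely many points of the union of a chain lie in a common member, the
    largest of the members chosen for the individual points. *)
Lemma chain_finite_subset (F : set (set T)) n (e : 'I_n -> T) :
  F !=set0 -> total_on F subset -> (forall i, (\bigcup_(X in F) X) (e i)) ->
  exists2 X, F X & forall i, X (e i).
Proof.
move=> [X0 FX0] totF; elim: n e => [|n IHn] e he; first by exists X0 => // -[].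
have [i|X FX hX] := IHn (fun i => e (widen_ord (leqnSn n) i)); first exact: he.
have [Y FY Ye] := he ord_max.
have wid (Z : set T) : Z (e ord_max) ->
    (forall i, Z (e (widen_ord (leqnSn n) i))) -> forall i, Z (e i).
  move=> Zmax Zwid i; have := ltn_ord i; rewrite ltnS leq_eqVlt => /orP[/eqP ein|lein].
    by rewrite (_ : i = ord_max) //; apply: val_inj.
  by rewrite (_ : i = widen_ord (leqnSn n) (Ordinal lein)) //; apply: val_inj.
have [XY|YX] := totF X Y FX FY.
  by exists Y => //; apply: wid => // i; apply: XY.
by exists X => //; apply: wid => //; apply: YX.
Qed.

End ZornChains.

Lemma submodule_chain (R : comNzRingType) (M : lmodType R) (F : set (set M)) :
  F !=set0 -> (forall X, F X -> submodule X) -> total_on F subset ->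
  submodule (\bigcup_(X in F) X).
Proof.
move=> [X0 FX0] subF totF; apply/submoduleP; split.
  exists X0; first exact: FX0.
  exact: submodule0 (subF _ FX0).
move=> a x y [X FX Xx] [Y FY Yy].
have [XY|YX] := totF X Y FX FY.
  have hY := subF _ FY; exists Y => //.
  by apply: submoduleD => //; apply: submoduleZ => //; apply: XY.
have hX := subF _ FX; exists X => //.
by apply: submoduleD => //; [apply: submoduleZ|apply: YX].
Qed.

Section FinitelyGenerated.
Variables (R : comNzRingType) (M : lmodType R).
Implicit Types N : set M.

Definition fg_submodule N : Prop :=
  exists (n : nat) (e : 'I_n -> M), generated_by e = N.

Lemma generated_by_submodule n (e : 'I_n -> M) : submodule (generated_by e).
Proof.
apply/submoduleP; split.
  by exists (fun=> 0) => //; rewrite big1 // => i _; rewrite scale0r.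
move=> a _ _ [c _ <-] [d _ <-]; exists (fun i => a * c i + d i) => //.
rewrite scaler_sumr -big_split; apply: eq_bigr => i _ /=.
by rewrite scalerDl scalerA.
Qed.

Lemma mem_generated_by n (e : 'I_n -> M) i : generated_by e (e i).
Proof.
exists (fun j => (j == i)%:R) => //; rewrite (bigD1 i) //= eqxx scale1r.
by rewrite big1 ?addr0 // => j /negPf ->; rewrite scale0r.
Qed.

Lemma generated_by_sub n (e : 'I_n -> M) N :
  submodule N -> (forall i, N (e i)) -> generated_by e `<=` N.
Proof.
by move=> hN he _ [c _ <-]; apply: submodule_sum => // i; apply: submoduleZ.
Qed.

Lemma fg_submoduleW N : fg_submodule N -> submodule N.
Proof. by case=> n [e <-]; apply: generated_by_submodule. Qed.

Lemma fg_cyclic_submodule x : fg_submodule (cyclic_submodule x).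
Proof.
exists 1%N, (fun=> x); apply/seteqP; split.
  apply: generated_by_sub; first exact: cyclic_submoduleP.
  by move=> _; apply: mem_cyclic_submodule.
move=> _ [a _ <-]; apply: submoduleZ; first exact: generated_by_submodule.
exact: (mem_generated_by (fun=> x) ord0).
Qed.

Lemma fg_submodule_add N1 N2 :
  fg_submodule N1 -> fg_submodule N2 -> fg_submodule (submodule_add N1 N2).
Proof.
move=> [n1 [e1 <-]] [n2 [e2 <-]].
pose e (i : 'I_(n1 + n2)) := match fintype.split i with inl j => e1 j | inr j => e2 j end.
have g1 := generated_by_submodule e1; have g2 := generated_by_submodule e2.
have g := generated_by_submodule e.
exists (n1 + n2)%N, e; apply/seteqP; split.
  apply: generated_by_sub; first exact: submodule_addP.
  move=> i; rewrite /e; case: fintype.split => j.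
    by apply: sub_submodule_addl => //; apply: mem_generated_by.
  by apply: sub_submodule_addr => //; apply: mem_generated_by.
move=> _ [x [y [hx hy ->]]]; apply: submoduleD => //.
  move: x hx; apply: generated_by_sub => // j.
  by have := mem_generated_by e (unsplit (inl j)); rewrite {2}/e unsplitK.
move: y hy; apply: generated_by_sub => // j.
by have := mem_generated_by e (unsplit (inr j)); rewrite {2}/e unsplitK.
Qed.

End FinitelyGenerated.

Section NoetherianModules.
Variables (R : comNzRingType) (M : lmodType R).
Hypothesis hR : noetherian R.
Implicit Types N : set M.

(** Induction on the number of generators. The coefficients of the last generator
    in the elements of N form an ideal J; lifts to N of finitely many generators
    of J, together with generators of the part of N that avoids the last
    generator, generate N. *)
Lemma noetherian_generated_by n (e : 'I_n -> M) N :
  submodule N -> N `<=` generated_by e -> fg_submodule N.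
Proof.
elim: n e N => [|n IHn] e N hN Ne.
  exists 0%N, e; apply/seteqP; split=> // _ [c _ <-].
  by rewrite big_ord0; apply: submodule0.
pose e' i := e (widen_ord (leqnSn n) i).
have g' := generated_by_submodule e'.
pose J : set R^o := [set c | exists2 x, generated_by e' x & N (c *: e ord_max + x)].
have hJ : ideal J.
  apply/submoduleP; split.
    by exists 0; [exact: submodule0|rewrite scale0r addr0; exact: submodule0].
  move=> a c d [x hx Nx] [y hy Ny]; exists (a *: x + y).
    by apply: submoduleD => //; apply: submoduleZ.
  have := submoduleD hN (submoduleZ a hN Nx) Ny.
  by rewrite scalerDr scalerA addrACA -scalerDl.
have [k [d dJ]] := hR hJ.
have /choice [x hx] : forall j, exists x, generated_by e' x /\ N ((d j : R) *: e ord_max + x).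
  by move=> j; have := mem_generated_by d j; rewrite dJ => -[x ? ?]; exists x.
pose y j := (d j : R) *: e ord_max + x j.
have gy := generated_by_submodule y.
have yN : generated_by y `<=` N by apply: generated_by_sub => // j; apply: (hx j).2.
have fgN' : fg_submodule (N `&` generated_by e').
  apply: (IHn e'); first exact: submoduleI.
  by move=> z [].
(* Subtracting from an element of N a combination of the lifts y removes its
   last coefficient. *)
suff -> : N = submodule_add (N `&` generated_by e') (generated_by y).
  by apply: fg_submodule_add => //; exists k, y.
apply/seteqP; split; last first.
  by move=> _ [u [v [[Nu _] /yN Nv ->]]]; apply: submoduleD.
move=> z Nz; have [c _] := Ne z Nz; rewrite big_ord_recr /= => zE.
have g'z : generated_by e' (\sum_(i < n) c (widen_ord (leqnSn n) i) *: e' i).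
  by exists (fun i => c (widen_ord (leqnSn n) i)).
have : J (c ord_max).
  by exists (\sum_(i < n) c (widen_ord (leqnSn n) i) *: e' i) => //; rewrite addrC zE.
rewrite -dJ => -[a _ caE].
pose w := \sum_(j < k) a j *: y j.
have gw : generated_by y w by exists a.
exists (z - w), w; split=> //; last by rewrite subrK.
split; first by apply: submoduleB => //; apply: yN.
have -> : z - w = \sum_(i < n) c (widen_ord (leqnSn n) i) *: e' i - \sum_(j < k) a j *: x j.
  rewrite -zE -caE /w scaler_suml -addrA; congr (_ + _).
  have -> : \sum_(j < k) a j *: y j = \sum_(j < k) ((a j *: d j : R) *: e ord_max + a j *: x j).
    by apply: eq_bigr => j _; rewrite /y scalerDr scalerA.
  by rewrite big_split /= opprD addrA subrr add0r.
apply: submoduleB => //; apply: submodule_sum => // j.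
by apply: submoduleZ => //; apply: (hx j).1.
Qed.

Lemma fg_submodule_sub N1 N2 :
  fg_submodule N2 -> submodule N1 -> N1 `<=` N2 -> fg_submodule N1.
Proof. by move=> [n [e <-]]; apply: noetherian_generated_by. Qed.

End NoetherianModules.

Lemma fg_submodule_image (R : comNzRingType) (M N : lmodType R)
    (f : {linear M -> N}) (A : set M) :
  fg_submodule A -> fg_submodule (f @` A).
Proof.
move=> [n [e <-]]; exists n, (f \o e); apply/seteqP; split.
  apply: generated_by_sub; first exact/submodule_image/generated_by_submodule.
  by move=> i; exists (e i) => //; apply: mem_generated_by.
move=> _ [_ [c _ <-] <-]; exists c => //.
by rewrite linear_sum; apply: eq_bigr => i _; rewrite linearZ.
Qed.

Section PrimeIdeals.
Variable R : comNzRingType.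
Hypothesis hR : noetherian R.
Implicit Types I p q : set R.

(** The union of a chain of ideals is finitely generated, so it equals a member of
    the chain. *)
Lemma noetherian_maximal (F : set (set R)) I0 :
  (forall I, F I -> ideal I) -> F I0 ->
  exists I, [/\ F I, I0 `<=` I & forall J, I `<=` J -> F J -> J = I].
Proof.
move=> idF FI0; apply: Zorn_above => // G G0 GF totG.
have /hR[n [e eE]] : ideal (\bigcup_(X in G) X).
  by apply: (@submodule_chain R R^o) => // X /GF /idF.
have [i|X GX Xe] := chain_finite_subset (e := e) G0 totG.
  by rewrite -[X in X _]eE; apply: mem_generated_by.
rewrite (_ : \bigcup_(X in G) X = X); first exact: GF.
apply/seteqP; split=> [|x Xx]; last by exists X.
have hX : ideal X by exact: idF (GF _ GX).
by rewrite -eE; apply: generated_by_sub hX Xe.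
Qed.

Definition ideal_adjoin I (a : R) : set R :=
  submodule_add (I : set R^o) (cyclic_submodule (a : R^o)).

Lemma ideal_adjoinP I a : ideal I -> ideal (ideal_adjoin I a).
Proof. by move=> hI; apply: submodule_addP hI _; apply: cyclic_submoduleP. Qed.

Lemma sub_ideal_adjoin I a : I `<=` ideal_adjoin I a.
Proof. exact: (@sub_submodule_addl R R^o I _ (cyclic_submoduleP _)). Qed.

Lemma mem_ideal_adjoin I a : ideal I -> ideal_adjoin I a a.
Proof.
by move=> hI; apply: (@sub_submodule_addr R R^o I _ hI); apply: mem_cyclic_submodule.
Qed.

Lemma ideal_adjoin_sub I a p : ideal p -> I `<=` p -> p a -> ideal_adjoin I a `<=` p.
Proof.
move=> hp Ip pa _ [x [_ [Ix [b _ <-] ->]]].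
by apply: (submoduleD hp); [exact: Ip|exact: (submoduleZ _ hp)].
Qed.

(** Noetherian induction. If an ideal J is maximal among the ideals for which this
    fails, then J is not prime, say a b is in J while a and b are not; every prime
    over J contains J + (a) or J + (b), and the finite sets obtained for these
    two larger ideals together serve for J. *)
Lemma finitely_many_primes_over I : ideal I ->
  exists S : set (set R), [/\ finite_set S,
    (forall p, S p -> prime_ideal p /\ I `<=` p) &
    forall q, prime_ideal q -> I `<=` q -> exists2 p, S p & p `<=` q].
Proof.
move=> hI; apply: contrapT => nI.
pose covered J := exists S : set (set R), [/\ finite_set S,
    (forall p, S p -> prime_ideal p /\ J `<=` p) &
    forall q, prime_ideal q -> J `<=` q -> exists2 p, S p & p `<=` q].
have [J []//|//|J [[hJ nJ] _ maxJ]] :=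
  @noetherian_maximal [set J | ideal J /\ ~ covered J] I.
have adj a : ~ J a -> covered (ideal_adjoin J a).
  move=> nJa; apply: contrapT => nadj; apply: nJa.
  rewrite -(maxJ (ideal_adjoin J a)); first exact: mem_ideal_adjoin.
    exact: sub_ideal_adjoin.
  by split=> //; apply: ideal_adjoinP.
have [J1|nJ1] := pselect (J 1).
  apply: nJ; exists set0; split=> // q [hq nq1 _] Jq.
  by case: nq1; apply: Jq.
have nprime : ~ prime_ideal J.
  move=> pJ; apply: nJ; exists [set J]; split; first exact: finite_set1.
    by move=> p ->; split.
  by move=> q _ Jq; exists J.
apply: nprime; split=> // a b Jab.
apply: contrapT => /not_orP[nJa nJb]; apply: nJ.
have [S [finS SJ Smin]] := adj a nJa; have [S' [finS' S'J S'min]] := adj b nJb.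
exists (S `|` S'); split; first by rewrite finite_setU.
  move=> p [/SJ|/S'J] [hp Jp]; split=> //; apply: subset_trans Jp;
    exact: sub_ideal_adjoin.
move=> q [hq nq1 qP] Jq; have [qa|qb] := qP a b (Jq _ Jab).
  by have [||p Sp pq] := Smin q; [|exact: ideal_adjoin_sub|exists p; [left|]].
by have [||p Sp pq] := S'min q; [|exact: ideal_adjoin_sub|exists p; [right|]].
Qed.

End PrimeIdeals.

(** * Finitely generated submodules with finitely supported quotient *)

Section RelativeSupport.
Variable R : comNzRingType.

(** The support of M/N. *)
Definition quotient_support (M : lmodType R) (N : set M) : set (set R) :=
  [set p | prime_ideal p /\ exists x : M, forall u, ~ p u -> ~ N (u *: x)].

(** This is the description of the kernel of M -> M_p. *)
Lemma fraction_eq0 (M : lmodType R) (p : set R) (x : M) s :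
  prime_ideal p -> ~ p s ->
  fraction p x s = fraction p 0 1 <-> exists2 u, ~ p u & u *: x = 0.
Proof.
move=> [hp np1 pM] nps; split=> [eqf|[u npu ux0]].
  have : fraction p x s (x, s).
    by split=> //; exists 1; rewrite // subrr scaler0.
  rewrite eqf => -[_ /= [u npu]]; rewrite scaler0 scale1r sub0r scalerN.
  by move/eqP; rewrite oppr_eq0 => /eqP ux0; exists u.
apply/seteqP; split=> -[y t] /= [npt [v npv]].
  rewrite scalerBr => /eqP; rewrite subr_eq0 => /eqP vE; split=> //=.
  exists (u * (v * s)); first by move/pM => [//|/pM[//|//]].
  rewrite scaler0 sub0r scale1r scalerN -2!scalerA -vE.
  by rewrite scalerA mulrC -scalerA [in u *: _]scalerA mulrC -scalerA ux0 !scaler0 oppr0.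
rewrite scaler0 sub0r scale1r scalerN => /eqP; rewrite oppr_eq0 => /eqP vy0; split=> //=.
exists (u * v); first by move/pM => [//|//].
rewrite scalerBr [in X in X - _]scalerA [in X in _ - X]scalerA.
rewrite -(mulrA u v s) (mulrC v s) mulrA -[in X in _ - X]scalerA vy0.
rewrite -(mulrA u) mulrC -scalerA ux0 !scaler0 subrr //.
Qed.

Lemma SuppE (M : lmodType R) : Supp M = quotient_support [set 0 : M].
Proof.
apply/seteqP; split=> p [pp hp]; split=> //.
  apply: contrapT => nx; apply: hp.
  have allx (x : M) : exists2 u, ~ p u & u *: x = 0.
    apply: contrapT => nu; apply: nx; exists x => u npu /= ux0.
    by apply: nu; exists u.
  case: (pp) => _ np1 _.
  apply/seteqP; split=> [_ [x [s [nps ->]]]|_ ->]; last by exists 0, 1.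
  exact/(fraction_eq0 _ pp nps).
case: (pp) => _ np1 _; case: hp => x hx eqloc.
have : localization p (fraction p x 1) by exists x, 1.
by rewrite eqloc => /(fraction_eq0 _ pp np1)[u /hx].
Qed.

End RelativeSupport.

(** In a short exact sequence S -> X -> M the image N of S is finitely generated
    and M is isomorphic to X/N. *)
Lemma fg_fs_classP (R : comNzRingType) (X : lmodType R) :
  extension_class (@fg_modules R) (@fs_modules R) X <->
  exists N : set X, fg_submodule N /\ finite_set (quotient_support N).
Proof.
split=> [[S [M [f [g [fgS fsM [_ rangef _]]]]]]|[N [fgN finN]]].
  exists (f @` setT); split; first exact: fg_submodule_image.
  apply: sub_finite_set fsM; rewrite SuppE => p [pp [x hx]]; split=> //.
  exists (g x) => u npu /= gx0; apply: (hx u npu).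
  by rewrite rangef /= linearZ.
have hN := fg_submoduleW fgN.
exists (submod hN), (quotmod hN), (@submod_incl _ _ _ hN), (@quotmod_pi _ _ _ hN).
split; last exact: short_exact_quotmod.
  have [n [e eN]] := fgN.
  have /choice[e' e'E] : forall i, exists y : submod hN, submod_incl y = e i.
    by move=> i; apply: submod_incl_surj; rewrite -[X in X _]eN; apply: mem_generated_by.
  exists n, e'; apply/seteqP; split=> // y _.
  have := submod_inclP y; rewrite -[X in X _]eN => -[c _ cE].
  exists c => //; apply: submod_incl_inj; rewrite -cE linear_sum.
  by apply: eq_bigr => i _; rewrite linearZ /= e'E.
apply: sub_finite_set finN; rewrite SuppE => p [pp [y hy]]; split=> //.
have [x xE] := quotmod_pi_surj y; exists x => u npu Nux; apply: (hy u npu).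
by rewrite /= -xE -linearZ; apply/quotmod_pi0.
Qed.

(** * The Serre property, and condition C_I in dimension 2 *)

Section SerreSubcategory.
Variable R : comNzRingType.
Hypothesis hR : noetherian R.
Let C := extension_class (@fg_modules R) (@fs_modules R).

Lemma fg_submodule_image_inj (M N : lmodType R) (f : {linear M -> N}) (A : set M) :
  injective f -> submodule A -> fg_submodule (f @` A) -> fg_submodule A.
Proof.
move=> injf hA [n [e eA]].
have /choice[e' he'] : forall i, exists x, A x /\ f x = e i.
  by move=> i; have := mem_generated_by e i; rewrite eA => -[x ? ?]; exists x.
exists n, e'; apply/seteqP; split.
  by apply: generated_by_sub => // i; apply: (he' i).1.
move=> x Ax; have : (f @` A) (f x) by exists x.
rewrite -eA => -[c _ cE]; exists c => //; apply: injf; rewrite -cE linear_sum.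
by apply: eq_bigr => i _; rewrite linearZ /= (he' i).2.
Qed.

Lemma fg_submodule_lift (M N : lmodType R) (g : {linear M -> N}) (B : set N) :
  surjective g -> fg_submodule B ->
  exists B' : set M, fg_submodule B' /\ g @` B' = B.
Proof.
move=> surjg [n [e eB]]; have /choice[e' he'] := fun i => surjg (e i).
exists (generated_by e'); split; first by exists n, e'.
rewrite -eB; apply/seteqP; split.
  move=> _ [_ [c _ <-] <-]; exists c => //; rewrite linear_sum.
  by apply: eq_bigr => i _; rewrite linearZ /= he'.
move=> _ [c _ <-]; exists (\sum_(i < n) c i *: e' i); first by exists c.
by rewrite linear_sum; apply: eq_bigr => i _; rewrite linearZ /= he'.
Qed.

(** For an extension of N by L with submodules B and A, the submodule chosen in the
    middle is the image of A plus a lift B' of B. If p is in neither support, then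
    for each x some multiple u x is in B' up to an element of L, and a further
    multiple moves that element into A. *)
Lemma fg_fs_serre : serre_subcategory C.
Proof.
split.
- move=> N M f injf /fg_fs_classP[A [fgA finA]]; apply/fg_fs_classP.
  exists (f @^-1` A); split.
    have hA := submodule_preimage f (fg_submoduleW fgA).
    apply: (fg_submodule_image_inj injf) => //.
    apply: (fg_submodule_sub hR fgA); first exact: submodule_image.
    by move=> _ [x Ax <-].
  apply: sub_finite_set finA => p [pp [x hx]]; split=> //; exists (f x) => u npu.
  by rewrite -linearZ; apply: hx.
- move=> M N g surjg /fg_fs_classP[A [fgA finA]]; apply/fg_fs_classP.
  exists (g @` A); split; first exact: fg_submodule_image.
  apply: sub_finite_set finA => p [pp [y hy]]; split=> //.
  have [x xy] := surjg y; exists x => u npu Aux; apply: (hy u npu).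
  by exists (u *: x); rewrite // linearZ /= xy.
move=> L M N f g [injf rangef surjg].
move=> /fg_fs_classP[A [fgA finA]] /fg_fs_classP[B [fgB finB]]; apply/fg_fs_classP.
have [B' [fgB' B'E]] := fg_submodule_lift surjg fgB.
exists (submodule_add (f @` A) B'); split.
  by apply: fg_submodule_add => //; apply: fg_submodule_image.
have finAB : finite_set (quotient_support A `|` quotient_support B).
  by rewrite finite_setU.
apply: sub_finite_set finAB => p [pp [x hx]].
apply: contrapT => /not_orP[nA nB].
have [u npu Bu] : exists2 u, ~ p u & B (u *: g x).
  apply: contrapT => nu; apply: nB; split=> //; exists (g x) => u npu Bu.
  by apply: nu; exists u.
move: Bu; rewrite -B'E -linearZ => -[b B'b gb].
have [l _ fl] : range f (u *: x - b) by rewrite rangef /= linearB /= gb subrr.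
have [v npv Av] : exists2 v, ~ p v & A (v *: l).
  apply: contrapT => nv; apply: nA; split=> //; exists l => v npv Av.
  by apply: nv; exists v.
apply: (hx (v * u)); first by case: (pp) => _ _ pM /pM[|].
exists (v *: (u *: x - b)), (v *: b); split.
- by exists (v *: l); rewrite // linearZ /= fl.
- exact: submoduleZ (fg_submoduleW fgB') B'b.
- by rewrite -scalerDr subrK scalerA.
Qed.

Lemma fg_fs_of_finite_support (M : lmodType R) : finite_support M -> C M.
Proof.
move=> finM; apply/fg_fs_classP; exists [set 0]; rewrite -SuppE; split=> //.
exists 0%N, (fun=> 0); apply/seteqP; split=> [_ [c _ <-]|_ ->].
  by rewrite big_ord0.
by exists (fun=> 0); rewrite // big_ord0.
Qed.

Lemma fg_fs_of_fg (M : lmodType R) : finitely_generated M -> C M.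
Proof.
move=> fgM; apply/fg_fs_classP; exists setT; split=> //.
rewrite (_ : quotient_support _ = set0) ?finite_set0 //.
apply/seteqP; split=> // p [[_ np1 _] [x hx]].
by apply: (hx 1).
Qed.

End SerreSubcategory.

Section Dimension2.
Variables (R : comNzRingType) (m : set R).
Hypotheses (hR : noetherian R) (hm : local_with_maximal_ideal m).

(** A maximal element among the proper ideals above I is a maximal ideal, so it
    is m. *)
Lemma proper_ideal_sub_max (I : set R) : ideal I -> ~ I 1 -> I `<=` m.
Proof.
move=> hI nI1.
have [J []//|//|J [[hJ nJ1] IJ maxJ]] :=
  @noetherian_maximal R hR [set J | ideal J /\ ~ J 1] I.
suff <- : J = m by [].
by apply: hm.2; split=> // K hK JK nK1; apply: maxJ.
Qed.

Lemma maximal_ideal_prime : prime_ideal m.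
Proof.
have [[hI nm1 maxm] _] := hm; split=> // a b mab.
apply: contrapT => /not_orP[nma nmb]; apply: nma.
rewrite -(maxm (ideal_adjoin m a)); first exact: mem_ideal_adjoin.
- exact: ideal_adjoinP.
- exact: sub_ideal_adjoin.
move=> [x [_ [mx [c _ <-] oneE]]]; apply: nmb.
have -> : b = b *: (x : R^o) + c *: (a * b : R^o).
  by rewrite /GRing.scale /= -[LHS]mulr1 oneE mulrDr /GRing.scale /= mulrCA (mulrC b a).
by apply: (submoduleD hI); apply: (submoduleZ _ hI).
Qed.

Lemma ideal_powX (I : set R) a n : I a -> ideal_pow I n (a ^+ n).
Proof.
move=> Ia; elim: n => [//|n IHn]; exists 1%N, (fun=> a), (fun=> a ^+ n).
by rewrite big_ord1 exprS.
Qed.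

Lemma prime_idealX (p : set R) a n : prime_ideal p -> p (a ^+ n) -> p a.
Proof.
by move=> [_ np1 pM]; elim: n => [/np1//|n IHn]; rewrite exprS => /pM[|/IHn].
Qed.

(** If a in I were outside p, then a power of a, also outside p, would kill a given
    x, so x would vanish in M_p. *)
Lemma Supp_Gamma (M : lmodType R) (I : set R) :
  Gamma I M = setT -> Supp M `<=` [set p | prime_ideal p /\ I `<=` p].
Proof.
move=> GM; rewrite SuppE => p [pp [x hx]]; split=> // a Ia.
have [n _ an] : Gamma I M x by rewrite GM.
apply: contrapT => npa; apply: (hx (a ^+ n)); last exact/an/ideal_powX.
by move/(prime_idealX pp).
Qed.

Hypotheses (domR : GRing.integral_domain_axiom R) (dimR : has_krull_dim R 2).

(** A prime q over I contains one of the finitely many primes p over I supplied by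
    [finitely_many_primes_over]; if q were different from p and m, then
    0 < p < q < m would be a chain of length 3. The first inclusion is strict since
    p contains the nonzero element a. *)
Lemma finite_primes_over_nonzero (I : set R) a :
  ideal I -> I a -> a <> 0 -> finite_set [set p | prime_ideal p /\ I `<=` p].
Proof.
move=> hI Ia a0; have [S [finS SI Smin]] := finitely_many_primes_over hR hI.
have finSm : finite_set (S `|` [set m]) by rewrite finite_setU.
apply: sub_finite_set finSm => q [pq Iq]; have [p Sp pq'] := Smin q pq Iq.
have [pp Ip] := SI p Sp.
have [->|npq] := pselect (q = p); first by left.
right; apply: contrapT => /= nqm.
pose c i := match i with 0%N => [set 0 : R] | 1%N => p | 2%N => q | _ => m end.
suff /dimR.2 : prime_chain 3 c by [].
have p0 : prime_ideal [set 0 : R].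
  split; first exact: (@submodule_set0 R R^o).
    by move=> /= /eqP; rewrite oner_eq0.
  by move=> x y /= /domR/orP[] /eqP; [left|right].
have ltP (A B : set R) : A `<=` B -> B <> A -> A `<` B.
  by move=> AB nAB; split=> // BA; apply: nAB; apply/seteqP.
split=> [[|[|[|[|//]]]] _|[|[|[|//]]] _] //=.
- exact: maximal_ideal_prime.
- split=> [x ->|/(_ a (Ip _ Ia))//].
  by case: pp => hp _ _; exact: (submodule0 hp).
- exact: ltP.
- apply: ltP => [|/esym//].
  by case: pq => hq nq1 _; apply: proper_ideal_sub_max.
Qed.

(** For a nonzero ideal I, the module M itself has finite support. For I = 0, M is
    a quotient of (0 :_M I) = M. *)
Lemma fg_fs_melkersson :
  melkersson_subcategory (extension_class (@fg_modules R) (@fs_modules R)).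
Proof.
split=> [|I hI M GM CM]; first exact: fg_fs_serre.
have [[a Ia a0]|I0] := pselect (exists2 a, I a & a <> 0).
  apply: fg_fs_of_finite_support; apply: sub_finite_set (Supp_Gamma GM) _.
  exact: finite_primes_over_nonzero Ia a0.
have [_ Cquot _] := fg_fs_serre hR.
have val_linear : linear (val : annihilated_mod I M -> M) by move=> b x y.
pose v := GRing.isLinear.Build R (annihilated_mod I M) M *:%R val val_linear.
pose vl : {linear annihilated_mod I M -> M} := HB.pack val v.
apply: (Cquot _ _ vl) CM => x.
have hx : x \in annihilated I (M := M).
  apply/asboolP => a Ia; have [->|/eqP a0] := eqVneq a 0; first exact: scale0r.
  by case: I0; exists a.
by exists (AnnihilatedMod hx).
Qed.

End Dimension2.

(** * Injective modules through functional graphs, and injective hulls *)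

Section GraphInjectivity.
Variable R : comNzRingType.

(** A submodule of B * E that is a functional relation is the same as a linear map
    from a submodule of B to E. *)
Definition functional_graph (B E : lmodType R) (G : set (B * E)) : Prop :=
  submodule G /\ forall y, G (0, y) -> y = 0.

(** Injectivity stated for partially defined linear maps; no module structure on
    their domains has to be built in order to use it. *)
Definition graph_injective (E : lmodType R) : Prop :=
  forall (B : lmodType R) (G : set (B * E)), functional_graph G ->
    exists h : {linear B -> E}, forall b y, G (b, y) -> h b = y.

Lemma functional_graph_inj (B E : lmodType R) (G : set (B * E)) b y z :
  functional_graph G -> G (b, y) -> G (b, z) -> y = z.
Proof.
move=> [hG G0] Gy Gz; apply/eqP; rewrite -subr_eq0; apply/eqP/G0.
have -> : (0 : B, y - z) = (b, y) - (b, z) :> B * E by rewrite -(subrr b).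
exact: submoduleB.
Qed.

(** A partial linear map G extends along the two projections of the module G, the
    first of which is injective; conversely, extending h along an injection f
    means extending the partial map with graph {(f x, h x)}. *)
Lemma graph_injectiveP (E : lmodType R) : injective_module E <-> graph_injective E.
Proof.
split=> [injE B G [hG G0]|injE A B f h injf].
  have fst_linear : linear (fun x : submod hG => (submod_incl x).1).
    by move=> a x y; rewrite linearP.
  have snd_linear : linear (fun x : submod hG => (submod_incl x).2).
    by move=> a x y; rewrite linearP.
  pose f : {linear submod hG -> B} :=
    HB.pack (fun x : submod hG => (submod_incl x).1)
      (GRing.isLinear.Build _ _ _ _ _ fst_linear).
  pose g : {linear submod hG -> E} :=
    HB.pack (fun x : submod hG => (submod_incl x).2)
      (GRing.isLinear.Build _ _ _ _ _ snd_linear).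
  have [|h hE] := injE (submod hG) B f g.
    move=> x y /= xy; apply: submod_incl_inj.
    apply/eqP; rewrite -subr_eq0 -linearB; apply/eqP.
    have := submod_inclP (x - y); rewrite !linearB /=.
    case: (submod_incl x) (submod_incl y) xy => [b z] [b' z'] /= ->.
    by rewrite -[_ - _]/(b' - b', z - z') subrr => /G0 ->.
  exists h => b y /submod_incl_surj[x xE].
  by have := hE x; rewrite /= xE.
have [|h' h'E] := injE B [set (f x, h x) | x in [set: A]].
  split.
    apply/submoduleP; split; first by exists 0; rewrite // !linear0.
    move=> a _ _ [x _ <-] [y _ <-]; exists (a *: x + y) => //.
    by rewrite !linearP.
  by move=> _ [x _ [fx0 <-]]; rewrite (injf x 0) ?linear0.
by exists h' => x; apply: h'E; exists x.
Qed.

(** Baer's criterion: partial maps need to be extended only from ideals. A maximal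
    functional graph G above the given one is total: if b is any element of B, the
    partial map from R to E sending a to G(a b) extends to R, say by 1 |-> y, and
    then the graph G + R (b, y) is still functional. *)
Lemma baer_criterion (E : lmodType R) :
  (forall G : set (R^o * E), functional_graph G ->
     exists y, forall (a : R) z, G (a, z) -> a *: y = z) ->
  graph_injective E.
Proof.
move=> baer B G0 fG0.
have [F F0 FP totF|G [fG G0G maxG]] := @Zorn_above _ [set G | functional_graph G] G0 fG0.
  split; first by apply: submodule_chain => // X /FP[].
  by move=> y [X /FP[_]]; apply.
have [hG zG] := fG.
have totG b : exists y, G (b, y).
  have [|y hy] := baer [set az | G ((az.1 : R) *: b, az.2)].
    split; last by move=> y; rewrite /= scale0r => /zG.
    apply/submoduleP; split; first by rewrite /= scale0r; exact: (submodule0 hG).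
    move=> a [c z] [d w] /= Gz Gw; rewrite scalerDl -scalerA.
    by have /submoduleP[_ /(_ a _ _ Gz Gw)] := hG.
  exists y; rewrite -(maxG (submodule_add G (cyclic_submodule (b, y)))).
  - exact/(sub_submodule_addr hG)/mem_cyclic_submodule.
  - exact/sub_submodule_addl/cyclic_submoduleP.
  split; first by apply: submodule_addP => //; apply: cyclic_submoduleP.
  move=> w [[x z] [_ [Gxz [a _ <-] /= [x0 ->]]]].
  rewrite (hy a (- z)) ?subrr //=.
  have -> : (a *: b, - z) = - (x, z) :> B * E.
    rewrite -[RHS]/(- x, - z); congr (_, _).
    by apply/eqP; rewrite -addr_eq0 addrC -x0.
  exact: submoduleN.
have /choice[h hG'] := totG.
have h_linear : linear h.
  move=> a x y; apply: (functional_graph_inj fG (hG' _)).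
  by have /submoduleP[_ /(_ a _ _ (hG' x) (hG' y))] := hG.
pose hl : {linear B -> E} := HB.pack h (GRing.isLinear.Build _ _ _ _ _ h_linear).
exists hl => b y /G0G Gby; exact: (functional_graph_inj fG (hG' b) Gby).
Qed.

Lemma linear_corestrict (X Y : lmodType R) (N : set Y) (hN : submodule N)
    (g : {linear X -> Y}) :
  (forall x, N (g x)) ->
  exists g' : {linear X -> submod hN}, forall x, submod_incl (g' x) = g x.
Proof.
move=> gN; have /choice[g' g'E] := fun x => submod_incl_surj hN (gN x).
have g'_linear : linear g'.
  by move=> a x y; apply: submod_incl_inj; rewrite linearP /= !g'E linearP.
pose gl : {linear X -> submod hN} :=
  HB.pack g' (GRing.isLinear.Build _ _ _ _ _ g'_linear).
by exists gl.
Qed.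

End GraphInjectivity.

Section InjectiveHull.
Variables (R : comNzRingType) (Q : lmodType R).
Hypothesis injQ : graph_injective Q.

Definition essential_over (M E : set Q) : Prop :=
  forall x, E x -> x <> 0 -> exists2 a, M (a *: x) & a *: x <> 0.

Lemma maximal_essential (M : set Q) : submodule M ->
  exists E, [/\ submodule E, M `<=` E, essential_over M E &
    forall E', submodule E' -> E `<=` E' -> essential_over M E' -> E' = E].
Proof.
move=> hM.
have [||E [[hE essE] ME maxE]] :=
  @Zorn_above Q [set E | submodule E /\ essential_over M E] M.
- by split=> // x Mx x0; exists 1; rewrite scale1r.
- move=> F F0 FP totF; split; first by apply: submodule_chain => // X /FP[].
  by move=> x [X FX Xx]; apply: (FP X FX).2.
by exists E; split=> // E' hE' EE' essE'; apply: maxE.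
Qed.

Lemma maximal_complement (E : set Q) : submodule E ->
  exists N, [/\ submodule N, N `&` E `<=` [set 0] &
    forall N', submodule N' -> N `<=` N' -> N' `&` E `<=` [set 0] -> N' = N].
Proof.
move=> hE.
have [||N [[hN NE] _ maxN]] :=
  @Zorn_above Q [set N | submodule N /\ N `&` E `<=` [set 0]] [set 0].
- by split; [exact: submodule_set0|move=> x []].
- move=> F F0 FP totF; split; first by apply: submodule_chain => // X /FP[].
  by move=> x [[X FX Xx] Ex]; apply: (FP X FX).2.
by exists N; split=> // N' hN' NN' N'E; apply: maxN.
Qed.

(** Let N be maximal among the submodules with N `&` E = 0. The map that is the
    identity on E and zero on N extends to phi : Q -> Q. By maximality of N, the
    image of phi is essential over E, hence over M, and so it equals E by
    maximality of E. *)
Lemma maximal_essential_retract (M E : set Q) :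
    submodule E -> essential_over M E ->
    (forall E', submodule E' -> E `<=` E' -> essential_over M E' -> E' = E) ->
  exists phi : {linear Q -> Q}, (forall x, E (phi x)) /\ forall x, E x -> phi x = x.
Proof.
move=> hE essE maxE; have [N [hN NE maxN]] := maximal_complement hE.
(* This is the graph of the projection of E + N onto E along N. *)
have [|phi phiE] := injQ (G := [set z | E z.2 /\ N (z.1 - z.2)]).
  split.
    apply/submoduleP; split; first by rewrite /= subr0; split; apply: submodule0.
    move=> a [x y] [x' y'] /= [Ey Nxy] [Ey' Nxy']; split.
      by apply: submoduleD => //; apply: submoduleZ.
    rewrite opprD addrACA -scalerBr.
    by apply: submoduleD => //; apply: submoduleZ.
  move=> y /= [Ey]; rewrite sub0r => /(submoduleN hN); rewrite opprK => Ny.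
  exact: NE.
have phi_id x : E x -> phi x = x.
  by move=> Ex; apply: phiE; rewrite /= subrr; split=> //; apply: submodule0.
have phi_N x : N x -> phi x = 0.
  by move=> Nx; apply: phiE; rewrite /= subr0; split=> //; apply: submodule0.
exists phi; split=> // x.
rewrite -(maxE (range phi)); first by exists x.
- exact/submodule_image/submoduleT.
- by move=> y Ey; exists y; rewrite ?phi_id.
move=> _ [y _ <-] phiy0; have [a Eay ay0] : exists2 a, E (a *: phi y) & a *: phi y <> 0.
  apply: contrapT => nay; apply: phiy0; apply: (phi_N _).
  rewrite -(maxN (submodule_add N (cyclic_submodule y))).
  - exact/(sub_submodule_addr hN)/mem_cyclic_submodule.
  - by apply: submodule_addP => //; apply: cyclic_submoduleP.
  - exact/sub_submodule_addl/cyclic_submoduleP.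
  move=> _ [[n [_ [Nn [a _ <-] ->]]] Ez] /=.
  have := phi_id _ Ez; rewrite linearD linearZ (phi_N _ Nn) add0r /= => phiz.
  by apply: contrapT => z0; apply: nay; exists a; rewrite phiz.
have [b Mb b0] := essE _ Eay ay0.
by exists (b * a); rewrite -scalerA.
Qed.

(** A maximal essential extension E of M inside the injective module Q is a retract
    of Q, and retracts of injective modules are injective. *)
Lemma exists_injective_hull (M : set Q) (hM : submodule M) :
  exists (E : lmodType R) (i : {linear submod hM -> E}), injective_hull i.
Proof.
have [E [hE ME essE maxE]] := maximal_essential hM.
have [phi [phiE phi_id]] := maximal_essential_retract hE essE maxE.
have [i iE] := linear_corestrict hE (g := @submod_incl _ _ _ hM)
  (fun x => ME _ (submod_inclP x)).
exists (submod hE), i; split.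
- by move=> x y ixy; apply: submod_incl_inj; rewrite -!iE ixy.
- move=> N hN Ni; apply/seteqP; split=> [x Nx|_ ->]; last exact: submodule0.
  apply: contrapT => /= x0.
  have [|a Max ax0] := essE _ (submod_inclP x).
    by move=> ix0; apply: x0; apply: submod_incl_inj; rewrite ix0 linear0.
  have [y yE] := submod_incl_surj hM Max.
  suff /= ax : [set 0] (a *: x) by apply: ax0; rewrite -linearZ ax linear0.
  rewrite -Ni; split; first exact: submoduleZ.
  by exists y => //; apply: submod_incl_inj; rewrite iE /= yE linearZ.
apply/graph_injectiveP => B G [hG G0].
have [|h hP] := injQ (G := [set (z.1, submod_incl z.2) | z in G]).
  split.
    apply/submoduleP; split; first by exists 0; [exact: submodule0|rewrite linear0].
    move=> a _ _ [x Gx <-] [y Gy <-]; exists (a *: x + y); last by rewrite linearP.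
    by apply: submoduleD => //; apply: submoduleZ.
  by move=> _ [[b x] Gbx [/= b0 <-]]; move: Gbx; rewrite b0 => /G0 ->; rewrite linear0.
have [h' h'E] := linear_corestrict hE (g := phi \o h) (fun x => phiE _).
exists h' => b y Gby; apply: submod_incl_inj; rewrite h'E /=.
rewrite (hP b (submod_incl y)); last by exists (b, y).
exact: phi_id (submod_inclP y).
Qed.

End InjectiveHull.

(** * An injective module containing a given cyclic module *)

Section IntModules.

Lemma int_ideal_principal (I : set int) :
  ideal I -> exists k : nat, forall n : int, I n <-> (k%:Z %| n)%Z.
Proof.
move=> hI; have [Ik|nI] := pselect (exists k, (0 < k)%N && `[< I k%:Z >]); last first.
  exists 0%N => n; rewrite dvd0z; split=> [In|/eqP->]; last exact: (submodule0 hI).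
  apply: contrapT => n0; apply: nI; exists `|n|%N.
  rewrite absz_gt0; apply/andP; split; first exact/negP.
  apply/asboolP; case: (intP n) In => [//|k|k] Ik; first exact: Ik.
  by rewrite abszN; have := submoduleN hI Ik; rewrite opprK.
case: (ex_minnP Ik) => k /andP[k0 /asboolP Ikk] kmin.
exists k => n; split=> [In|/dvdzP[q ->]]; last exact: (submoduleZ q hI).
have Ir : I (n %% k)%Z.
  have -> : (n %% k)%Z = n - (n %/ k)%Z * k by rewrite {2}(divz_eq n k) addrC addKr.
  by apply: (submoduleB hI In); apply: (submoduleZ _ hI).
have kn0 : k%:Z != 0 by rewrite eqz_nat -lt0n.
apply/dvdz_mod0P/eqP; apply: contrapT => /negP r0.
have := kmin `|(n %% k)%Z|%N.
rewrite absz_gt0 r0 gez0_abs ?modz_ge0 //= => /(_ (asboolT Ir)).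
by rewrite -lez_nat gez0_abs ?modz_ge0 // leNgt ltz_pmod.
Qed.

Lemma scale_intE (D : lmodType int) (n : int) (d : D) : n *: d = d *~ n.
Proof. by rewrite -[n in LHS]intz scaler_int. Qed.

Definition divisible (D : lmodType int) : Prop :=
  forall (d : D) (k : nat), (0 < k)%N -> exists y : D, k%:Z *: y = d.

(** By Baer's criterion and since the domain of a partial map from the integers is
    k Z for some k: it suffices to divide the value at k by k. *)
Lemma divisible_graph_injective (D : lmodType int) : divisible D -> graph_injective D.
Proof.
move=> divD; apply: baer_criterion => G [hG G0].
have [|k kP] := @int_ideal_principal [set n | exists z, G (n, z)].
  apply/submoduleP; split; first by exists 0; exact: (submodule0 hG).
  move=> a n n' [z Gz] [z' Gz']; exists (a *: z + z').
  by have /submoduleP[_ /(_ a _ _ Gz Gz')] := hG.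
have [z Gkz] : exists z, G (k%:Z, z) by apply/kP; rewrite dvdzz.
(* When k = 0, functionality gives z = 0. *)
have [y yE] : exists y, k%:Z *: y = z.
  have [k0|/divD] := posnP k; last exact.
  by exists 0; rewrite scaler0 [RHS]G0 // -[X in (X, _)]/(0%N%:Z) -k0.
exists y => a w Gaw; have /dvdzP[q aE] : (k%:Z %| a)%Z by apply/kP; exists w.
apply: (functional_graph_inj (conj hG G0) _ Gaw).
rewrite aE -scalerA yE; exact: (submoduleZ q hG Gkz).
Qed.

Definition integers : set (zmodule rat) := [set n%:~R | n in [set: int]].

Lemma integers_submodule : submodule integers.
Proof.
apply/submoduleP; split; first by exists 0.
move=> a _ _ [n _ <-] [n' _ <-]; exists (n * a + n') => //.
by rewrite scalezrE rmorphD rmorphM /= mulrzr.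
Qed.

Definition rat_mod_int : lmodType int := quotmod integers_submodule.

Lemma rat_mod_int_divisible : divisible rat_mod_int.
Proof.
move=> d k k0; have [x <-] := quotmod_pi_surj d.
exists (quotmod_pi integers_submodule (x / k%:R : rat)); rewrite -linearZ /=.
have kn0 : k%:R != 0 :> rat by rewrite pnatr_eq0 -lt0n.
have xk : (x / k%:R) *~ k%:Z = x :> rat by rewrite -pmulrn -[LHS]mulr_natr divfK.
by rewrite scalezrE; congr quotmod_pi; exact: xk.
Qed.

(** The class of 1/k works if k > 1; for k = 0 any nonzero class does. *)
Lemma rat_mod_int_torsion (k : nat) :
  k != 1%N -> exists d : rat_mod_int, d <> 0 /\ k%:Z *: d = 0.
Proof.
move=> k1; pose c := if k == 0%N then 2%N else k.
have c0 : c%:R != 0 :> rat.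
  by rewrite pnatr_eq0 /c; case: (eqVneq k 0%N).
exists (quotmod_pi integers_submodule (c%:R^-1 : rat)); split.
  move/quotmod_pi0 => [n _ nE].
  have : n * c%:Z = 1.
    by apply: (@intr_inj rat); rewrite rmorphM /= nE -pmulrn mulVf.
  move/(congr1 absz); rewrite abszM /= => /eqP; rewrite muln_eq1 => /andP[_].
  by rewrite /c; case: (eqVneq k 0%N) => [_ |_]; rewrite ?(negPf k1).
rewrite -linearZ /=; apply/quotmod_pi0.
rewrite scalezrE; have [->|kn0] := eqVneq k 0%N.
  by rewrite mulr0z; exact: (submodule0 integers_submodule).
exists 1 => //; have -> : k = c by rewrite /c (negPf kn0).
by rewrite -pmulrn -[RHS]mulr_natr mulVf.
Qed.

End IntModules.

Section Coinduction.
Variables (R : comNzRingType) (D : lmodType int).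

Definition additive_maps : {pred R -> D} :=
  [pred f | `[< {morph f : x y / x - y} >]].

Fact additive_maps_closed : zmod_closed additive_maps.
Proof.
split; first by apply/asboolP => x y; rewrite subr0.
move=> f g /asboolP hf /asboolP hg; apply/asboolP => x y.
by rewrite !fctE /= hf hg opprD addrACA -opprD.
Qed.

HB.instance Definition _ :=
  GRing.isZmodClosed.Build (R -> D) additive_maps additive_maps_closed.

(** The R-module Hom_Z(R, D), with (a f)(r) = f(r a). *)
Record coind : Type := Coind {
  coind_val :> R -> D;
  _ : coind_val \in additive_maps }.

HB.instance Definition _ := [isSub for coind_val].
HB.instance Definition _ := [Choice of coind by <:].
HB.instance Definition _ := [SubChoice_isSubZmodule of coind by <:].

Lemma coindB (f : coind) x y : f (x - y) = f x - f y.
Proof. by case: f => f hf /=; move/asboolP: hf => ->. Qed.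

HB.instance Definition _ (f : coind) :=
  GRing.isZmodMorphism.Build R D (coind_val f) (coindB f).

Fact coind_scale_subproof (a : R) (f : coind) :
  (fun r => f (r * a)) \in additive_maps.
Proof. by apply/asboolP => x y; rewrite mulrBl raddfB. Qed.

Definition coind_scale a f : coind := Coind (coind_scale_subproof a f).

Lemma coindP (f g : coind) : (forall r, f r = g r) -> f = g.
Proof. by move=> fg; apply: val_inj; apply/funext. Qed.

Fact coind_scaleA a b f : coind_scale a (coind_scale b f) = coind_scale (a * b) f.
Proof. by apply: coindP => r /=; rewrite mulrA. Qed.
Fact coind_scale1 : left_id 1 coind_scale.
Proof. by move=> f; apply: coindP => r /=; rewrite mulr1. Qed.
Fact coind_scaleDr : right_distributive coind_scale +%R.
Proof. by move=> a f g; apply: coindP. Qed.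
Fact coind_scaleDl f : {morph coind_scale^~ f : a b / a + b}.
Proof. by move=> a b; apply: coindP => r /=; rewrite mulrDr raddfD. Qed.

HB.instance Definition _ := GRing.Zmodule_isLmodule.Build R coind
  coind_scaleA coind_scale1 coind_scaleDr coind_scaleDl.

Lemma coind_scaleE a (f : coind) r : (a *: f) r = f (r * a).
Proof. by []. Qed.

(** R-linear maps from B to Hom_Z(R, D) correspond to additive maps from B to D by
    evaluation at 1; under this correspondence, partial R-linear maps become
    partial additive maps, which extend. *)
Lemma coind_graph_injective : graph_injective D -> graph_injective coind.
Proof.
move=> injD B G [hG G0].
pose H : set (zmodule B * D) := [set (z.1 : zmodule B, z.2 1) | z in G].
have [|g gP] := injD (zmodule B) H.
  split; last by move=> _ [[b f] Gbf [/= b0 <-]]; move: Gbf; rewrite b0 => /G0 ->.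
  apply/submoduleP; split; first by exists 0; first exact: submodule0.
  move=> n _ _ [[b f] Gz <-] [[c k] Gw <-]; exists (n%:~R *: (b, f) + (c, k)).
    by apply: submoduleD => //; apply: submoduleZ.
  congr (_, _); first by rewrite /= scaler_int.
  rewrite -[LHS]/(f (1 * n%:~R) + k 1) mul1r raddfMz.
  by rewrite -[RHS]/(n *: f 1 + k 1) scale_intE.
have h_add b : (fun r : R => g (r *: b : zmodule B)) \in additive_maps.
  by apply/asboolP => x y; rewrite scalerBl; exact: (linearB g).
pose h b : coind := Coind (h_add b).
have h_linear : linear h.
  move=> a x y; apply: coindP => r /=.
  by rewrite scalerDr scalerA; exact: (linearD g).
pose hl : {linear B -> coind} := HB.pack h (GRing.isLinear.Build _ _ _ _ _ h_linear).
exists hl => b f Gbf; apply: coindP => r /=.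
apply: gP; exists (r *: b, r *: f); last by rewrite /= mul1r.
exact: (submoduleZ r hG Gbf).
Qed.

End Coinduction.

Section CyclicAnnihilator.
Variables (R : comNzRingType) (p : set R).
Hypothesis hp : ideal p.

(** The class of x in R/p generates a nonzero cyclic group, which is Z/k with
    k <> 1; sending that class to a nonzero element of Q/Z killed by k and
    extending by injectivity of Q/Z gives a character. *)
Lemma exists_character x : ~ p x ->
  exists phi : R -> rat_mod_int,
    [/\ {morph phi : a b / a - b}, forall a, p a -> phi a = 0 & phi x <> 0].
Proof.
move=> npx.
have [|k kP] := @int_ideal_principal [set n | p (x *~ n)].
  apply/submoduleP; split; first by rewrite /= mulr0z; exact: (submodule0 hp).
  move=> a n n' pn pn'; rewrite /= mulrzDr /=; apply: (submoduleD hp) => //.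
  by rewrite [a *: n]mulrC mulrzA -mulrzr mulrC; exact: (submoduleZ _ hp).
have k1 : k != 1%N.
  by apply/eqP => k1; apply: npx; apply/(kP 1); rewrite k1 dvd1z.
have [d [d0 kd]] := rat_mod_int_torsion k1.
pose G : set (zmodule R * rat_mod_int) :=
  [set z | exists n : int, p (z.1 - x *~ n) /\ z.2 = n *: d].
have [|phi phiP] := divisible_graph_injective rat_mod_int_divisible (G := G).
  split.
    apply/submoduleP; split.
      by exists 0; rewrite mulr0z subr0 scale0r; split=> //; exact: (submodule0 hp).
    move=> a [u v] [u' v'] [n [/= pu ->]] [n' [/= pu' ->]].
    exists (a * n + n'); split; last by rewrite scalerDl -scalerA.
    rewrite /= scalezrE mulrzDr opprD addrACA; apply: (submoduleD hp) => //.
    rewrite mulrC mulrzA -mulrzBl -mulrzl.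
    exact: (submoduleZ _ hp).
  move=> y [n [/=]]; rewrite sub0r => /(submoduleN hp); rewrite opprK => /(kP n).
  by move=> /dvdzP[q ->] ->; rewrite -scalerA kd scaler0.
exists phi; split=> [a b|a pa|].
- exact: (linearB phi).
- by apply: phiP; exists 0; rewrite /= mulr0z subr0 scale0r.
rewrite (phiP x d) //; exists 1; rewrite /= mulr1z subrr scale1r.
by split=> //; exact: (submodule0 hp).
Qed.

(** The element e of Hom_Z(R, D), where D is the product of copies of Q/Z indexed by
    the elements x of R, collects characters phi x of R/p with phi x x <> 0 for x
    outside p: if a e = 0, then evaluating at 1 and at the index a gives
    phi a a = 0, so a is in p. *)
Lemma exists_injective_annihilator :
  exists (Q : lmodType R) (e : Q),
    graph_injective Q /\ forall a, a *: e = 0 <-> p a.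
Proof.
have char x : exists phi : R -> rat_mod_int,
    [/\ {morph phi : a b / a - b}, forall a, p a -> phi a = 0 & ~ p x -> phi x <> 0].
  have [px|npx] := pselect (p x); last by have [phi []] := exists_character npx; exists phi.
  by exists (fun=> 0); split=> // a b; rewrite subr0.
have /choice[phi phiP] := char.
pose D : lmodType int := R -> rat_mod_int.
have e_add : (fun r : R => (fun x => phi x r) : D) \in @additive_maps R D.
  by apply/asboolP => a b; apply/funext => x; have [-> _ _] := phiP x.
exists (coind R D), (Coind e_add); split.
  apply/coind_graph_injective/divisible_graph_injective => d k k0.
  have /choice[y yE] := fun x => rat_mod_int_divisible (d x) k0.
  by exists y; apply/funext => x; rewrite -yE.
move=> a; split=> [ae0|pa].
  apply: contrapT => npa; have [_ _ /(_ npa)] := phiP a; apply.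
  have /(congr1 (fun f : coind R D => f 1 a)) := ae0.
  by rewrite coind_scaleE /= mul1r.
apply: coindP => r; apply/funext => x; rewrite coind_scaleE /=.
have [_ phip0 _] := phiP x; apply: phip0; exact: (@submoduleZ R R^o p r a hp pa).
Qed.

End CyclicAnnihilator.

(** * Injective hulls with infinite support *)

(** Nakayama's lemma localized at q, without fractions: a module that is generated
    by the e i and equals r times itself locally at q is killed by some d outside
    q. By induction on the number of generators: the relation for the last one
    reads (u - r a) e_n = r (combination of the others) with u - r a outside q,
    so after multiplication by w = u - r a the last generator can be eliminated
    from the other relations. *)
Lemma nakayama_prime (R : comNzRingType) (M : lmodType R) (q : set R) r n
    (e : 'I_n -> M) :
    prime_ideal q -> q r ->
    (forall i, exists u z, [/\ ~ q u, generated_by e z & u *: e i = r *: z]) ->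
  exists2 d, ~ q d & forall i, d *: e i = 0.
Proof.
move=> [hq nq1 qM] qr; elim: n e => [|n IHn] e eP; first by exists 1 => // -[].
pose e' i := e (widen_ord (leqnSn n) i).
have g' := generated_by_submodule e'.
have [u [_ [nqu [a _ <-] uE]]] := eP ord_max.
pose w := u - r * a ord_max.
have nqw : ~ q w.
  move=> qw; apply: nqu; rewrite -(subrK (r * a ord_max) u).
  apply: (submoduleD hq) => //; rewrite mulrC; exact: (submoduleZ _ hq).
have [x g'x wE] : exists2 x, generated_by e' x & w *: e ord_max = r *: x.
  exists (\sum_(i < n) a (widen_ord (leqnSn n) i) *: e' i).
    by exists (fun i => a (widen_ord (leqnSn n) i)).
  by rewrite scalerBl uE big_ord_recr /= scalerDr scalerA addrK.
have [i|d nqd de'] := IHn e'.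
  have [v [_ [nqv [b _ <-] vE]]] := eP (widen_ord (leqnSn n) i).
  exists (w * v), (w *: (\sum_(j < n) b (widen_ord (leqnSn n) j) *: e' j)
                   + (r * b ord_max) *: x); split.
  - by case/qM.
  - apply: submoduleD => //; apply: submoduleZ => //.
    by exists (fun j => b (widen_ord (leqnSn n) j)).
  rewrite -scalerA vE big_ord_recr /= [r *: (_ + _)]scalerDr scalerDr.
  rewrite scalerDr ![w *: (r *: _)]scalerA ![r *: (w *: _)]scalerA [w * r]mulrC.
  congr (_ + _); rewrite scalerA -[r * w * b _]mulrA -[r * (w * _)]/(_).
  rewrite [w * b _]mulrC mulrA -scalerA wE !scalerA; congr (_ *: x).
  by rewrite mulrAC -!mulrA.
exists (d * w); first by case/qM.
move=> i; have := ltn_ord i; rewrite ltnS leq_eqVlt => /orP[/eqP ein|lein].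
  have -> : i = ord_max by apply: val_inj.
  rewrite -scalerA wE scalerA mulrC -scalerA.
  suff -> : d *: x = 0 by rewrite scaler0.
  have [c _ <-] := g'x; rewrite scaler_sumr big1 // => j _.
  by rewrite scalerA mulrC -scalerA de' scaler0.
have -> : i = widen_ord (leqnSn n) (Ordinal lein) by apply: val_inj.
by rewrite mulrC -scalerA de' scaler0.
Qed.

Section NotInjectiveHullClosed.
Variables (R : comNzRingType) (p : set R) (E : lmodType R) (e : E).
Hypotheses (hR : noetherian R) (pp : prime_ideal p) (injE : graph_injective E).
Hypothesis ann_e : forall a, a *: e = 0 <-> p a.

(** Extend the map r R + p -> E that sends r to x and p to 0; it is well defined
    because r b in p forces b in p. The value at 1 is the required y. *)
Lemma injective_divide r (x : E) : ~ p r -> (forall a, p a -> a *: x = 0) ->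
  exists y, r *: y = x /\ forall a, p a -> a *: y = 0.
Proof.
move=> npr px; have [hp np1 pM] := pp.
have [|h hP] := injE (B := R^o)
    (G := [set z | exists b : R, p ((z.1 : R) - r * b) /\ z.2 = b *: x]).
  split.
    apply/submoduleP; split.
      by exists 0; rewrite mulr0 subr0 scale0r; split=> //; exact: (submodule0 hp).
    move=> a [u v] [u' v'] [b [/= pb ->]] [c [/= pc ->]].
    exists (a * b + c); split; last by rewrite scalerDl -scalerA.
    rewrite /= mulrDr mulrCA opprD addrACA -mulrBr.
    by apply: (submoduleD hp) => //; apply: (submoduleZ _ hp).
  move=> y [b [/=]]; rewrite sub0r => /(submoduleN hp); rewrite opprK.
  by move=> /pM[//|/px] bx0 ->.
exists (h 1); split=> [|a pa].
  rewrite -linearZ; apply: hP; exists 1; rewrite scale1r; split=> //=.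
  by rewrite -[r *: 1]/(r * 1) subrr; exact: (submodule0 hp).
rewrite -linearZ; apply: hP; exists 0; rewrite scale0r; split=> //=.
by rewrite -[a *: 1]/(a * 1) mulr0 subr0 mulr1.
Qed.

(** Otherwise every element of E has a multiple in S by an element outside q. For the
    submodule P of elements killed by p this makes the finitely generated module
    S `&` P satisfy the hypothesis of [nakayama_prime] with r in q outside p, so it
    is killed by some d outside q. But a multiple u e with u outside q is in
    S `&` P, so d u is in the annihilator p of e, which is contained in q. *)
Lemma quotient_support_injective (S : set E) (q : set R) :
  fg_submodule S -> prime_ideal q -> p `<=` q -> q <> p -> quotient_support S q.
Proof.
move=> fgS pq pq' qp; split=> //; apply: contrapT => nx.
have locS x : exists2 u, ~ q u & S (u *: x).
  apply: contrapT => nu; apply: nx; exists x => u nqu Sux; apply: nu.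
  by exists u.
have [r qr npr] : exists2 r, q r & ~ p r.
  apply: contrapT => nr; apply: qp; apply/seteqP; split=> // r qr.
  by apply: contrapT => npr; apply: nr; exists r.
have hS := fg_submoduleW fgS.
pose P := [set x : E | forall a, p a -> a *: x = 0].
have hP : submodule P.
  apply/submoduleP; split=> [a _|a x y Px Py b pb]; first by rewrite scaler0.
  by rewrite scalerDr scalerA mulrC -scalerA Px // Py // scaler0 addr0.
have [n [f fE]] : fg_submodule (S `&` P).
  by apply: (fg_submodule_sub hR fgS); [exact: submoduleI|move=> x []].
have [i|d nqd df] := nakayama_prime (e := f) pq qr.
  have [Sf Pf] : (S `&` P) (f i) by rewrite -fE; apply: mem_generated_by.
  have [y [ryf Py]] := injective_divide npr Pf.
  have [u nqu Suy] := locS y.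
  exists u, (u *: y); split=> //.
    by rewrite fE; split=> //; exact: (submoduleZ u hP Py).
  by rewrite -ryf !scalerA mulrC.
have [u nqu Sue] := locS e.
have : (S `&` P) (u *: e).
  by split=> // a pa; rewrite scalerA mulrC -scalerA (ann_e a).2 ?scaler0.
rewrite -fE => -[c _ cE].
have [_ _ qM] := pq; case: (qM d u) => //; apply: pq'; apply/ann_e.
rewrite -scalerA -cE scaler_sumr big1 // => i _.
by rewrite scalerA mulrC -scalerA df scaler0.
Qed.

End NotInjectiveHullClosed.

Lemma infinite_primes_over_prime (R : comNzRingType) :
  noetherian R -> infinite_set (Spec R) ->
  exists2 p : set R, prime_ideal p & infinite_set [set q | prime_ideal q /\ p `<=` q].
Proof.
move=> hR infR; apply: contrapT => np; apply: infR.
have [S [finS SP Smin]] :=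
  finitely_many_primes_over hR (@submodule_set0 R R^o : ideal [set 0 : R]).
apply: (@sub_finite_set _ _ (\bigcup_(p in S) [set q | prime_ideal q /\ p `<=` q])).
  move=> q pq; have [x ->|p Sp pq'] := Smin q pq; last by exists p.
  by case: pq => hq _ _; exact: (submodule0 hq).
apply: bigcup_finite => // p Sp; apply: contrapT => infp.
by apply: np; exists p => //; apply: (SP p Sp).1.
Qed.

(** The hull is that of a cyclic module R e isomorphic to R/p, for a prime p that
    lies in infinitely many primes. *)
Lemma fg_fs_not_closed_under_injective_hulls (R : comNzRingType) :
  noetherian R -> infinite_set (Spec R) ->
  ~ closed_under_injective_hulls (extension_class (@fg_modules R) (@fs_modules R)).
Proof.
move=> hR /(infinite_primes_over_prime hR)[p pp infp] hullC.
have [hp _ _] := pp.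
have [Q [e [injQ ann_e]]] := exists_injective_annihilator hp.
have hM := cyclic_submoduleP e.
have [E [i hull_i]] := exists_injective_hull injQ hM.
have fgM : finitely_generated (submod hM).
  apply: (fg_submodule_image_inj (f := @submod_incl _ _ _ hM)).
  - exact: submod_incl_inj.
  - exact: submoduleT.
  - by rewrite range_submod_incl; apply: fg_cyclic_submodule.
have /fg_fs_classP[S [fgS finS]] := hullC _ _ i hull_i (fg_fs_of_fg fgM).
have [i_inj _ /graph_injectiveP injE] := hull_i.
have [e' e'E] := submod_incl_surj hM (mem_cyclic_submodule e).
have ann_ie a : a *: i e' = 0 <-> p a.
  have inclZ : submod_incl (a *: e') = a *: e by rewrite linearZ /= e'E.
  rewrite -ann_e -inclZ -linearZ; split=> [|ae0].
    by rewrite -(linear0 i) => /i_inj ->; rewrite linear0.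
  by rewrite (_ : a *: e' = 0) ?linear0 //; apply: submod_incl_inj; rewrite ae0 linear0.
apply: infp; have : finite_set (quotient_support S `|` [set p]) by rewrite finite_setU.
apply: sub_finite_set => q [pq pq']; have [->|qp] := pselect (q = p); first by right.
left; exact: (quotient_support_injective hR pp injE ann_ie).
Qed.

Theorem theorem3p1 (R : comNzRingType) (m : set R)
    (hR : noetherian R) (hm : local_with_maximal_ideal m) :
  [/\ infinite_set (Spec R) ->
        ~ closed_under_injective_hulls
            (extension_class (@fg_modules R) (@fs_modules R)),
      GRing.integral_domain_axiom R -> has_krull_dim R 2 ->
        melkersson_subcategory
          (extension_class (@fg_modules R) (@fs_modules R)) &
      GRing.integral_domain_axiom R -> has_krull_dim R 2 ->
        infinite_set (Spec R) ->
        melkersson_subcategory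
          (extension_class (@fg_modules R) (@fs_modules R)) /\
        ~ closed_under_injective_hulls
            (extension_class (@fg_modules R) (@fs_modules R))].
Proof.
have notC := fg_fs_not_closed_under_injective_hulls hR.
have melk := fg_fs_melkersson hR hm.
by split=> // domR dimR infR; split; [exact: melk|exact: notC].
Qed.
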